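(* If $\Omega$ is an almost John domain, then it is finitely connected at the boundary.
   Context: Setting: $(X,d,\mu)$ is a metric measure space with more than one point, $\mu$ is a Borel measure with $0<\mu(B)<\infty$ for all balls $B$, and $1\le p<\infty$ is fixed. $X$ is complete, $\mu$ is doubling (there is $C_\mu>0$ with $\mu(B(x,2r))\le C_\mu\mu(B(x,r))$ for all balls), and $X$ supports a $p$-Poincaré inequality: there are $C_{PI}>0$, $\lambda\ge1$ such that for all balls $B$ and all $u\in N^{1,p}(X)$, $\frac{1}{\mu(B)}\int_B|u-u_B|\,d\mu\le C_{PI}\operatorname{diam}(B)\bigl(\frac{1}{\mu(\lambda B)}\int_{\lambda B}g_u^p\,d\mu\bigr)^{1/p}$, where $u_B=\frac{1}{\mu(B)}\int_B u\,d\mu$. Here a nonnegative Borel function $g$ is an upper gradient of $u:X\to[-\infty,\infty]$ if for every nonconstant rectifiable curve $\gamma:[0,l_\gamma]\to X$ parameterized by arc length, $|u(\gamma(0))-u(\gamma(l_\gamma))|\le\int_\gamma g\,ds$ when both values are finite, and $\int_\gamma g\,ds=\infty$ otherwise; $N^{1,p}(X)$ is the space of measurable $u$ with $\int_X|u|^p\,d\mu+\inf_g\int_X g^p\,d\mu<\infty$ (infimum over upper gradients $g$ of $u$), and $g_u$ is the minimal $p$-weak upper gradient of $u$ (the a.e.-smallest $L^p$ function satisfying the upper gradient inequality for all curves except a family $\Gamma$ for which some nonnegative Borel $\rho\in L^p(X)$ has $\int_\gamma\rho\,ds=\infty$ for all $\gamma\in\Gamma$). $\Omega\subsetneq X$ is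 a bounded domain (bounded nonempty connected open set). John domains: write $\delta_\Omega(x)=\operatorname{dist}(x,X\setminus\Omega)$. A domain $\Omega$ is a John domain if there are $C_\Omega\ge1$ and $x_0\in\Omega$ such that every $x\in\Omega$ can be joined to $x_0$ by a rectifiable curve $\gamma:[0,l_\gamma]\to\Omega$ parameterized by arc length with $\gamma(0)=x$, $\gamma(l_\gamma)=x_0$ and $t\le C_\Omega\delta_\Omega(\gamma(t))$ for $0\le t\le l_\gamma$. The 1-dimensional Hausdorff content is $\mathcal H^1_\infty(E)=\inf\{\sum_{j=1}^\infty r_j: E\subset\bigcup_{j=1}^\infty B(x_j,r_j)\}$. A domain $\Omega$ is an almost John domain if for each $r>0$ there is a closed set $F\subset\overline\Omega$ such that $\mathcal H^1_\infty(F)<r$ and $\Omega\setminus F$ is a John domain (the John constant and center may depend on $r$). Finite connectedness: $\Omega$ is finitely connected at $x_0\in\partial\Omega$ if for every $r>0$ there is an open set $G\subset X$ with $x_0\in G\subset B(x_0,r)$ such that $G\cap\Omega$ has only finitely many components. $\Omega$ is finitely connected at the boundary if this holds at every $x_0\in\partial\Omega$. *)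

(* Defs.v *)
From HB Require Import structures.
From mathcomp Require Import all_boot all_order all_algebra.
From mathcomp Require Import all_classical all_reals all_analysis.
From mathcomp Require Import measurable_realfun.

Set Implicit Arguments.
Unset Strict Implicit.
Unset Printing Implicit Defensive.

Import Order.TTheory GRing.Theory Num.Theory.
Import numFieldNormedType.Exports.

Local Open Scope classical_set_scope.
Local Open Scope ring_scope.

(* A measurableType has to be pointed, hence the pointed metric spaces. *)
#[short(type="pmetricType")]
HB.structure Definition PointedMetric (R : numDomainType) :=
  {X of Metric R X & isPointed X}.

#[short(type="completeMetricType")]
HB.structure Definition CompleteMetric (R : numDomainType) :=
  {X of PointedMetric R X & Complete X}.

(* X with its Borel sigma-algebra; convertible to X. *)
Notation borelType X := (g_sigma_algebraType (@open X)).

Section Curves.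
Context {R : realType} {X : metricType R}.
Implicit Types (gamma : R -> X) (a b l : R).

Definition curve_variation gamma a b (s : seq R) : R :=
  let F := gamma \o nth b (a :: s) in
  \sum_(0 <= i < size s) mdist (F i) (F i.+1).

Definition curve_length gamma a b : \bar R :=
  ereal_sup [set (curve_variation gamma a b s)%:E | s in itv_partition a b].

(* A curve [0, l] -> X is a function R -> X of which only the values on [0, l]
   matter. *)
Definition arc_length_curve l gamma : Prop :=
  [/\ 0 <= l,
      {within `[0, l], continuous gamma} &
      forall s t : R, 0 <= s -> s <= t -> t <= l ->
        curve_length gamma s t = (t - s)%:E].

Definition nonconstant_curve l gamma : Prop :=
  exists2 t, t \in `[0, l] & gamma t <> gamma 0.

End Curves.

Section Newtonian.
Context {R : realType} {X : pmetricType R}.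
Variables (mu : {measure set (borelType X) -> \bar R}) (p : R).
Implicit Types (u g rho : X -> \bar R) (l : R) (gamma : R -> X).
Local Open Scope ereal_scope.

Definition curve_integral g l gamma : \bar R :=
  \int[lebesgue_measure]_(t in `[0%R, l]) g (gamma t).

Definition borel_fun u : Prop :=
  measurable_fun [set: borelType X] (u : borelType X -> \bar R).

Definition nonneg_borel g : Prop := (forall x, 0 <= g x) /\ borel_fun g.

Definition integral_pow u : \bar R :=
  \int[mu]_(x in [set: borelType X]) (`|u x| `^ p).

Definition upper_gradient_ineq u g l gamma : Prop :=
  if (u (gamma 0%R) \is a fin_num) && (u (gamma l) \is a fin_num)
  then (`|u (gamma 0%R) - u (gamma l)| <= curve_integral g l gamma : Prop)
  else curve_integral g l gamma = +oo.

Definition upper_gradient u g : Prop :=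
  nonneg_borel g /\
  forall l gamma, arc_length_curve l gamma -> nonconstant_curve l gamma ->
    upper_gradient_ineq u g l gamma.

Definition exceptional (Gamma : set (R * (R -> X))) : Prop :=
  exists rho, [/\ nonneg_borel rho, integral_pow rho < +oo &
    forall l gamma, arc_length_curve l gamma -> nonconstant_curve l gamma ->
      Gamma (l, gamma) -> curve_integral rho l gamma = +oo].

(* Weak upper gradients are taken Borel: modifying one on a mu-null set only
   affects the inequality along an exceptional family of curves. *)
Definition weak_upper_gradient u g : Prop :=
  nonneg_borel g /\
  exists2 Gamma, exceptional Gamma &
    forall l gamma, arc_length_curve l gamma -> nonconstant_curve l gamma ->
      ~ Gamma (l, gamma) -> upper_gradient_ineq u g l gamma.

Definition minimal_weak_upper_gradient u gu : Prop :=
  [/\ weak_upper_gradient u gu, integral_pow gu < +oo &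
      forall g, weak_upper_gradient u g -> integral_pow g < +oo ->
        {ae mu, forall x : borelType X, gu x <= g x}].

Definition newtonian u : Prop :=
  borel_fun u /\
  integral_pow u + ereal_inf [set integral_pow g | g in upper_gradient u]
    < +oo.

Definition average (A : set X) (f : X -> \bar R) : \bar R :=
  (mu A)^-1 * \int[mu]_(x in (A : set (borelType X))) f x.

Definition diam (A : set X) : \bar R :=
  ereal_sup [set (mdist y z)%:E | y in A & z in A].

Definition doubling : Prop :=
  exists2 C : R, (0 < C)%R &
    forall (x : X) (r : R), (0 < r)%R ->
      mu (ball x (2 * r)%R) <= C%:E * mu (ball x r).

(* The minimal weak upper gradient g_u exists for every Newtonian u and is
   unique up to a mu-null set; "exists2 gu" is the description of "the g_u". *)
Definition poincare : Prop :=
  exists C lam : R, [/\ (0 < C)%R, (1 <= lam)%R &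
    forall u, newtonian u ->
      exists2 gu, minimal_weak_upper_gradient u gu &
        forall (x : X) (r : R), (0 < r)%R ->
          average (ball x r)
            (fun y => `|u y - average (ball x r) u|)
          <= C%:E * diam (ball x r) *
             average (ball x (lam * r)%R) (fun y => gu y `^ p) `^ (p^-1)%R].

End Newtonian.

Section Domains.
Context {R : realType} {X : metricType R}.
Implicit Types (Omega F E : set X).

Definition domain Omega : Prop :=
  [/\ Omega !=set0, connected Omega & open Omega].

Definition bounded_subset E : Prop :=
  exists (x : X) (r : R), E `<=` ball x r.

Definition john_domain Omega : Prop :=
  domain Omega /\
  exists (C : R) (x0 : X), [/\ 1 <= C, Omega x0 &
    forall x, Omega x ->
      exists (l : R) (gamma : R -> X),
        [/\ arc_length_curve l gamma, gamma 0 = x, gamma l = x0 &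
            forall t : R, 0 <= t <= l -> Omega (gamma t) /\
              (t%:E <= C%:E * edist_inf (~` Omega) (gamma t))%E]].

Definition hausdorff_content1 E : \bar R :=
  ereal_inf [set s | exists (c : nat -> X) (r : nat -> R),
    [/\ forall j, 0 < r j,
        E `<=` \bigcup_j ball (c j) (r j) &
        s = (\sum_(0 <= j <oo) (r j)%:E)%E]].

Definition almost_john_domain Omega : Prop :=
  domain Omega /\
  forall r : R, 0 < r ->
    exists F, [/\ closed F, F `<=` closure Omega,
      (hausdorff_content1 F < r%:E)%E & john_domain (Omega `\` F)].

Definition boundary E : set X := closure E `\` interior E.

Definition components E : set (set X) :=
  [set connected_component E x | x in E].

Definition finitely_connected_at Omega (x0 : X) : Prop :=
  forall r : R, 0 < r ->
    exists G, [/\ open G, G x0, G `<=` ball x0 r &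
      finite_set (components (G `&` Omega))].

Definition finitely_connected_at_boundary Omega : Prop :=
  forall x0, boundary Omega x0 -> finitely_connected_at Omega x0.

End Domains.

(* Main.v *)
(* Applying the Poincare inequality to the indicator function of one half of a
   splitting of a ball B(x, rho) into two open sets, cut off near the boundary
   of the ball, shows that the splitting cannot separate the points of the
   smaller ball B(x, theta rho). Hence the quasicomponents of open sets are
   open, so they are components, and the component of y in an open set V
   contains B(y, theta rho) whenever B(y, rho) lies in V.
   Let x be a boundary point, V = B(x, r) /\ Omega, and F a closed set of
   content < r / 8 such that Omega \ F is John. A component of V that meets
   B(x, r / 4) has points at all distances from r / 4 to 3 r / 4 from x (unless
   it is Omega), so it is not covered by F in that annulus, because the map
   d(x, .) does not increase the content. Following a John curve from a point of
   it outside F for time r / 8, one reaches the John center or a point whose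
   distance to the complement of V is bounded below. So all but one of these
   components have measure bounded below by doubling, and as they are disjoint
   there are finitely many of them. *)
Require Import Defs.
From HB Require Import structures.
From mathcomp Require Import all_boot all_order all_algebra.
From mathcomp Require Import all_classical all_reals all_analysis.
From mathcomp Require Import measurable_realfun.
From mathcomp Require Import lra ring.

Set Implicit Arguments.
Unset Strict Implicit.
Unset Printing Implicit Defensive.

Import Order.TTheory GRing.Theory Num.Theory.
Import numFieldNormedType.Exports.

Local Open Scope classical_set_scope.
Local Open Scope ring_scope.

(** * Quasicomponents and components of open sets *)

Section Metric.
Context {R : realType} {X : metricType R}.
Implicit Types (x y z : X) (A B F U V W : set X) (r s : R).

Lemma openP_ball A :
  open A <-> forall x, A x -> exists2 r, 0 < r & ball x r `<=` A.
Proof.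
rewrite openE; split=> [oA x /oA /nbhs_ballP[r /= r0 rA]|oA x /oA[r r0 rA]].
  by exists r.
by apply/nbhs_ballP; exists r.
Qed.

Lemma open_ball x r : open (ball x r).
Proof.
apply/openP_ball => y; rewrite ballEmdist/= => xy.
exists (r - mdist x y); first by rewrite subr_gt0.
move=> z; rewrite !ballEmdist/= ltrBrDl.
exact/le_lt_trans/metric_triangle.
Qed.

Lemma mdist_lipschitz x y z : `|mdist x y - mdist x z| <= mdist y z.
Proof.
rewrite ler_norml; apply/andP; split.
  by rewrite lerBrDr addrC lerBlDr metric_triangle.
by rewrite lerBlDl -(metric_sym z y) metric_triangle.
Qed.

Lemma arc_length_curve_lipschitz (l : R) (gamma : R -> X) :
  arc_length_curve l gamma -> forall s t : R, 0 <= s -> s <= t -> t <= l ->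
    mdist (gamma s) (gamma t) <= t - s.
Proof.
move=> [l0 _ len] s t s0 st tl.
move: st; rewrite le_eqVlt => /predU1P[->|st]; first by rewrite mdistxx subrr.
rewrite -lee_fin -(len s t s0 (ltW st) tl); apply: ereal_sup_ubound => /=.
exists [:: t]; first exact: itv_partition1.
by rewrite /curve_variation/= big_nat1.
Qed.

(** For open [V] this is the intersection of the relatively clopen subsets of [V] containing [x],
    each given as one half [U] of a splitting. *)
Definition quasicomponent V x : set X :=
  [set y | V y /\ forall U W, open U -> open W -> U `&` W = set0 ->
    U `|` W = V -> U x -> U y].

Lemma quasicomponent_refl V x : V x -> quasicomponent V x x.
Proof. by move=> Vx; split. Qed.

(** The form in which the Poincare inequality enters the topology. As [U] and [W] only have to cover
    the ball, splittings of larger sets qualify. *)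
Definition unsplit_balls (theta : R) : Prop :=
  forall x r U W, 0 < r -> open U -> open W -> U `&` W = set0 ->
    ball x r `<=` U `|` W -> U x -> ball x (theta * r) `<=` U.

Section Unsplit.
Variable theta : R.
Hypotheses (theta0 : 0 < theta) (theta1 : theta <= 1)
  (unsplit : unsplit_balls theta).

(** Every splitting of [V] also splits the ball around [y], and its half containing [x] contains [y]
    too. *)
Lemma ball_quasicomponent V x y r : ball y r `<=` V ->
  quasicomponent V x y -> ball y (theta * r) `<=` quasicomponent V x.
Proof.
move=> yrV [Vy Qy] z yz.
have r0 : 0 < r.
  rewrite -(pmulr_rgt0 _ theta0) (le_lt_trans _ (_ : mdist y z < _)) ?mdist_ge0//.
  by move: yz; rewrite ballEmdist.
split.
  apply: yrV; apply: le_ball yz.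
  by rewrite -[leRHS]mul1r ler_wpM2r// ltW.
move=> U W oU oW UW UWV Ux.
apply: (unsplit r0 oU oW UW) yz; first by rewrite UWV.
exact: (Qy U W).
Qed.

Lemma open_quasicomponent V x : open V -> open (quasicomponent V x).
Proof.
move=> /openP_ball oV; apply/openP_ball => y Qy.
have [r r0 yrV] := oV _ Qy.1.
exists (theta * r); first exact: mulr_gt0.
exact: ball_quasicomponent.
Qed.

(** A point off the quasicomponent is cut off from [x] by some splitting, whose open half around
    that point misses the quasicomponent. *)
Lemma open_setD_quasicomponent V x :
  open V -> open (V `\` quasicomponent V x).
Proof.
move=> oV; apply/openP_ball => y [Vy Qy].
have [U [W [oU oW UW UWV [Ux Uy]]]] : exists U W,
    [/\ open U, open W, U `&` W = set0, U `|` W = V & U x /\ ~ U y].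
  apply: contra_notP Qy => h; split=> // U W oU oW UW UWV Ux.
  by apply: contra_notP h => Uy; exists U, W.
have Wy : W y by move: Vy; rewrite -UWV => -[].
have [r r0 yrW] := (openP_ball W).1 oW _ Wy.
exists r => // z /yrW Wz; split; first by rewrite -UWV; right.
by move=> [_ /(_ U W oU oW UW UWV Ux)] Uz; have : set0 z by rewrite -UW.
Qed.

(* A splitting of the quasicomponent Q extends to a splitting of V, as both Q
   and V \ Q are open. *)
Lemma connected_quasicomponent V x :
  open V -> V x -> connected (quasicomponent V x).
Proof.
move=> oV Vx B [b Bb] [C oC BC] [D cD BD].
have oQ := open_quasicomponent x oV; have oQ' := open_setD_quasicomponent x oV.
set Q := quasicomponent V x in BC BD oQ oQ' *.
have QV : Q `<=` V by move=> ? [].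
have oB : open B by rewrite BC; exact: openI.
have oQB : open (Q `\` B).
  rewrite (_ : _ `\` _ = Q `&` ~` D); first exact/openI/closed_openC.
  rewrite BD; apply/seteqP; split=> z [Qz h]; split=> //.
    by move=> Dz; apply: h.
  by move=> [].
have BQ : B `<=` Q by rewrite BC; exact: subIsetl.
have [Bx|Bx] := pselect (B x).
  apply/seteqP; split=> // y [Vy Qy].
  apply: (Qy B ((Q `\` B) `|` (V `\` Q))) => //; first exact: openU.
    apply/seteqP; split=> // z [Bz [[]//|[_]]]; apply; exact: BQ.
  apply/seteqP; split=> z.
    by move=> [/BQ/QV//|[[/QV]|[]]].
  move=> Vz; have [Bz|Bz] := pselect (B z); [by left|right].
  by have [Qz|Qz] := pselect (Q z); [left|right].
(* Now [x] lies in the part of [Q] outside [B], which would then have to contain [b]. *)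
have [_ Qb] : Q b by exact: BQ.
suff [] : (Q `\` B) b by [].
apply: (Qb (Q `\` B) (B `|` (V `\` Q))) => //; first exact: openU.
- by apply/seteqP; split=> // z [[Qz Bz] [//|[]]].
- apply/seteqP; split=> z.
    by move=> [[/QV]//|[/BQ/QV|[]]].
  move=> Vz; have [Bz|Bz] := pselect (B z); [by right; left|].
  by have [Qz|Qz] := pselect (Q z); [left|right; right].
Qed.

Lemma ball_sub_component V y r : open V -> 0 < r -> ball y r `<=` V ->
  ball y (theta * r) `<=` connected_component V y.
Proof.
move=> oV r0 yrV; have Vy : V y by apply: yrV; exact: ballxx.
apply: (@subset_trans _ (quasicomponent V y)).
  by apply: ball_quasicomponent => //; exact: quasicomponent_refl.
apply: connected_component_max; first exact: quasicomponent_refl.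
  by move=> ? [].
exact: connected_quasicomponent.
Qed.

Lemma open_connected_component V x : open V -> open (connected_component V x).
Proof.
move=> oV; apply/openP_ball => y Vxy.
have [r r0 yrV] := (openP_ball V).1 oV _ (connected_component_sub Vxy).
exists (theta * r); first exact: mulr_gt0.
by rewrite (same_connected_component Vxy); exact: ball_sub_component.
Qed.

End Unsplit.
End Metric.

(** * Upper gradients of locally Lipschitz functions *)

Section Gradient.
Context {R : realType}.

(** Real induction: the supremum of the points related to [a] can be reached and, unless it is [b],
    passed. *)
Lemma local_to_global_rel (P : R -> R -> Prop) (a b : R) :
  (forall r s t, r <= s -> s <= t -> P r s -> P s t -> P r t) ->
  (forall c, exists2 e, 0 < e &
    forall s t, c - e < s -> s <= t -> t < c + e -> P s t) ->
  a <= b -> P a b.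
Proof.
move=> Ptrans Ploc ab.
pose S := [set t | a <= t <= b /\ P a t].
have Sa : S a.
  split; first by rewrite lexx.
  by have [e e0] := Ploc a; apply; rewrite ?lexx// ?ltrDl// gtrBl.
have hS : has_sup S.
  by split; [exists a|exists b => t [/andP[]]].
have [e e0 Pe] := Ploc (sup S).
have [t [/andP[at_ tb] Pat] te] := sup_adherent e0 hS.
have tS : t <= sup S by apply: ub_le_sup; [exact: hS.2|split=> //; apply/andP].
have Sb : sup S <= b by apply: ge_sup; [exists a|move=> ? [/andP[]]].
pose t' := Num.min b (sup S + e / 2).
have tt' : t <= t' by rewrite le_min tb/= (le_trans tS)// lerDl divr_ge0// ltW.
have St' : P a t'.
  apply: (Ptrans _ t) => //; apply: Pe => //.
  by rewrite gt_min; apply/orP; right; rewrite ltrD2l ltr_pdivrMr// ltr_pMr// ltr1n.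
suff -> : b = t' by [].
apply/eqP; rewrite eq_le ge_min lexx/= andbT.
have : t' <= sup S.
  apply: ub_le_sup; first exact: hS.2.
  by split=> //; rewrite (le_trans at_)//= ge_min lexx.
rewrite /t' ge_min => /orP[bS|]; last by rewrite gerDl leNgt divr_gt0.
by rewrite le_min lexx/= (le_trans bS)// lerDl divr_ge0// ltW.
Qed.

Context {X : pmetricType R}.
Implicit Types (x y z : X) (A : set X) (gamma : R -> X).

Lemma measurable_open A : open A -> measurable (A : set (borelType X)).
Proof. by move=> oA; exact: sub_sigma_algebra. Qed.

(** A plain Lipschitz bound would not record where [u] is locally constant; this one makes [K] times
    the indicator of [A] an upper gradient. *)
Definition locally_lipschitz_on A (K : R) (u : X -> R) : Prop :=
  forall x, exists2 e, 0 < e &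
    (forall y, ball x e y -> u y = u x) \/
    (ball x e `<=` A /\
     forall y z, ball x e y -> ball x e z -> `|u y - u z| <= K * mdist y z).

Section LocallyLipschitz.
Variables (A : set X) (K : R) (u : X -> R).
Hypotheses (oA : open A) (K0 : 0 <= K) (uA : locally_lipschitz_on A K u).

Lemma locally_lipschitz_on_continuous : continuous u.
Proof.
move=> x; have [e e0 ue] := uA x; apply/cvgrPdist_le => /= eps eps0.
case: ue => [ue|[_ ue]].
  apply/nbhs_ballP; exists e => //= y /ue ->; by rewrite subrr normr0 ltW.
(* The denominator [K + 1] covers the case [K = 0]. *)
have d0 : 0 < Num.min e (eps / (K + 1)).
  by rewrite lt_min e0 divr_gt0// ltr_wpDl.
apply/nbhs_ballP; exists (Num.min e (eps / (K + 1))) => //= y.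
rewrite ballEmdist/= lt_min => /andP[xye xyK].
apply: (le_trans (ue _ _ _ _)); rewrite ?ballEmdist/= ?mdistxx//.
apply: (@le_trans _ _ ((K + 1) * mdist x y)).
  by rewrite ler_wpM2r ?mdist_ge0// lerDl.
by rewrite mulrC -ler_pdivlMr ?ltr_wpDl// ltW.
Qed.

(** The inequality passes from adjacent parameter intervals to their union, so short ones suffice;
    there [u] is constant along [gamma] or the integrand is [K] throughout. *)
Lemma curve_integral_ge_variation l gamma : 0 <= l ->
  (forall s t, mdist (gamma s) (gamma t) <= `|s - t|) ->
  (`|u (gamma 0) - u (gamma l)|%:E <=
    curve_integral (fun x => (K * \1_A x)%:E) l gamma)%E.
Proof.
move=> l0 lip; rewrite /curve_integral.
pose G (t : R) := (K * \1_A (gamma t))%:E.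
have og : open (gamma @^-1` A).
  rewrite openE => t At; have [r r0 rA] := (openP_ball A).1 oA _ At.
  apply/nbhs_ballP; exists r => //= s; rewrite /ball/= => ts; apply: rA.
  by rewrite ballEmdist/=; exact: le_lt_trans ts.
have mG D : measurable_fun D G.
  apply: (@measurable_funS _ _ _ _ setT) => //; apply/measurable_EFinP.
   apply: (@measurable_funM _ _ _ _ (cst K)) => //.
  rewrite (_ : (fun x : R => _) = \1_(gamma @^-1` A)); last by [].
  by apply: measurable_indic; exact: open_measurable.
have G0 t : (0 <= G t)%E by rewrite lee_fin mulr_ge0.
(* Half-open intervals make adjacent pieces disjoint, so that their integrals add up. *)
rewrite -integral_itv_obnd_cbnd; last exact: mG.
apply: (@local_to_global_rel (fun s t => `|u (gamma s) - u (gamma t)|%:E <=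
   \int[lebesgue_measure]_(z in `]s, t]) G z)%E) => //.
  move=> r s t rs st Prs Pst.
  have -> : `]r, t]%classic = `]r, s] `|` `]s, t].
    by rewrite -itv_bndbnd_setU ?bnd_simp.
  rewrite ge0_integral_setU//=; [|exact: mG|]; last first.
    apply/disj_set2P; rewrite -subset0 => z [] /=; rewrite !in_itv/=.
    by move=> /andP[_ zs] /andP[]; rewrite ltNge zs.
  apply: le_trans (leeD Prs Pst); rewrite -EFinD lee_fin.
  exact: ler_distD.
move=> c; have [e e0 ue] := uA (gamma c); exists e => // s t cs st tc.
have inball q : s <= q -> q <= t -> ball (gamma c) e (gamma q).
  move=> sq qt; rewrite ballEmdist/= (le_lt_trans (lip _ _))// ltr_norml.
  by apply/andP; split; lra.
case: ue => [ue|[eA ue]].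
  rewrite (ue _ (inball s _ _))// (ue _ (inball t _ _))//.
  by rewrite subrr normr0 integral_ge0.
rewrite (@eq_integral _ _ _ _ _ (cst K%:E)); last first.
  move=> z; rewrite inE/= in_itv/= => /andP[sz zt]; rewrite /G indicE mem_set ?mulr1//.
  by apply: eA; apply: inball => //; exact: ltW.
rewrite integral_cst//= lebesgue_measure_itv/= lte_fin.
apply: (@le_trans _ _ (K * (t - s))%:E).
  rewrite lee_fin; apply: (le_trans (ue _ _ (inball s _ _) (inball t _ _))) => //.
  rewrite ler_wpM2l// (le_trans (lip _ _))// distrC ger0_norm//.
  by rewrite subr_ge0.
case: ltP => [_|ts]; first by rewrite -EFinD -EFinM.
have -> : s = t by apply/eqP; rewrite eq_le st ts.
by rewrite subrr mulr0 mule0.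
Qed.

Lemma locally_lipschitz_on_upper_gradient :
  upper_gradient (EFin \o u) (fun x => (K * \1_A x)%:E).
Proof.
split; first split.
- by move=> x; rewrite lee_fin mulr_ge0.
- apply/measurable_EFinP; apply: (@measurable_funM _ _ _ _ (cst K)) => //.
  by apply: measurable_indic; exact: measurable_open.
move=> l gamma cgamma _; rewrite /upper_gradient_ineq/=.
(* Freezing the curve outside [[0, l]] makes it 1-Lipschitz on the whole line and keeps the
   integral. *)
pose clamp t := Num.max 0 (Num.min t l).
have l0 : 0 <= l by case: cgamma.
have clampE t : 0 <= t -> t <= l -> clamp t = t.
  by move=> t0 tl; rewrite /clamp; move/min_idPl: tl => ->; exact/max_idPr.
have lip := arc_length_curve_lipschitz cgamma.
have clip s t : s <= t -> mdist (gamma (clamp s)) (gamma (clamp t)) <= t - s.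
  move=> st.
  have cl q : 0 <= clamp q <= l.
    by rewrite /clamp le_max lexx/= ge_max l0/= ge_min lexx orbT.
  have h : clamp s <= clamp t /\ clamp t - clamp s <= t - s.
    rewrite /clamp; case: (leP s l) => ?; case: (leP t l) => ?;
    case: (leP 0 s) => ?; case: (leP 0 t) => ?; case: (leP 0 l) => ?; split; lra.
  apply: le_trans h.2; apply: lip h.1 _; first by case/andP: (cl s).
  by case/andP: (cl t).
have := @curve_integral_ge_variation l (gamma \o clamp) l0.
rewrite /= !clampE// => /(_ _)/le_trans; apply.
  move=> s t; case: (leP s t) => st.
    by rewrite distrC ger0_norm ?subr_ge0// clip.
  by rewrite metric_sym gtr0_norm ?subr_gt0// clip// ltW.
rewrite le_eqVlt; apply/orP; left; apply/eqP; apply: eq_integral => t.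
by rewrite inE/= in_itv/= => /andP[t0 tl]; rewrite clampE.
Qed.

End LocallyLipschitz.
End Gradient.

(** * The test function of a splitting of a ball *)

Section Cutoff.
Context {R : realType} {X : pmetricType R}.
Implicit Types (x y z : X) (U W A : set X).

Definition cutoff (s : R) : R := Num.max 0 (Num.min 1 (3 - 4 * s)).

Lemma cutoff_lipschitz s t : `|cutoff s - cutoff t| <= 4 * `|s - t|.
Proof.
rewrite /cutoff; wlog st : s t / s <= t.
  move=> h; case: (leP s t) => [/h//|/ltW/h].
  by rewrite distrC (distrC t s).
rewrite (distrC s) (ger0_norm (_ : 0 <= t - s)) ?subr_ge0// ler_norml.
case: (leP 1 (3 - 4 * s)) => ?; case: (leP 1 (3 - 4 * t)) => ?;
  rewrite ?(max_r ler01);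
  case: (leP 0 (3 - 4 * s)) => ?; case: (leP 0 (3 - 4 * t)) => ?;
  apply/andP; split; lra.
Qed.

Lemma cutoff_id s : s <= 2^-1 -> cutoff s = 1.
Proof.
move=> s2; rewrite /cutoff (min_idPl _) ?(max_idPr _)//; lra.
Qed.

Lemma cutoff_eq0 s : 3 / 4 <= s -> cutoff s = 0.
Proof. by move=> s2; apply/max_idPl; rewrite ge_min; apply/orP; right; lra. Qed.

Lemma cutoff_ge0 s : 0 <= cutoff s. Proof. by rewrite le_max lexx. Qed.

Lemma cutoff_le1 s : cutoff s <= 1.
Proof. by rewrite ge_max ler01/= ge_min lexx. Qed.

Variables (x : X) (rho : R) (U W : set X).
Hypotheses (rho0 : 0 < rho) (oU : open U) (oW : open W) (UW : U `&` W = set0)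
  (UWx : ball x rho `<=` U `|` W).

(** It contains the transition zone of the cutoff, from [rho / 2] to [3 / 4 * rho], and avoids the
    ball of radius [rho / 4], where the gradient has to vanish. *)
Definition annulus : set X := [set y | rho / 4 < mdist x y < rho].

Lemma open_annulus : open annulus.
Proof.
apply/openP_ball => y /andP[y1 y2].
exists (Num.min (mdist x y - rho / 4) (rho - mdist x y)).
  by rewrite lt_min !subr_gt0 y1.
move=> z; rewrite ballEmdist/= lt_min => /andP[z1 z2].
have := mdist_lipschitz x y z; rewrite ler_norml => /andP[z3 z4].
by rewrite /annulus/=; apply/andP; split; lra.
Qed.

Definition split_fun y : R :=
  \1_(U `&` ball x rho) y * cutoff (mdist x y / rho).

Lemma split_fun_in y : U y -> mdist x y < rho / 2 -> split_fun y = 1.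
Proof.
move: (rho0) => rho_gt0 Uy xy; rewrite /split_fun indicE mem_set ?mul1r; last first.
  by split=> //; rewrite ballEmdist/=; lra.
by rewrite cutoff_id// ler_pdivrMr//; lra.
Qed.

Lemma split_fun_notin y : W y -> split_fun y = 0.
Proof.
move=> Wy; rewrite /split_fun indicE memNset ?mul0r//.
by move=> [Uy _]; have : set0 y by rewrite -UW.
Qed.

Lemma split_fun_far y : 3 / 4 * rho <= mdist x y -> split_fun y = 0.
Proof.
by move=> xy; rewrite /split_fun cutoff_eq0 ?mulr0// ler_pdivlMr.
Qed.

(** Inside the ball the indicator is locally constant, since the open sets [U] and [W] are disjoint
    and cover it; the cutoff removes the jump at the sphere and is the only factor that varies. *)
Lemma split_fun_lipschitz :
  locally_lipschitz_on annulus (4 / rho) split_fun.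
Proof.
move: (rho0) => rho_gt0 y; have [Wy|Wy] := pselect (W y).
  have [e e0 yeW] := (openP_ball _).1 oW _ Wy.
  exists e => //; left => z /yeW Wz.
  by rewrite !split_fun_notin.
case: (ltP (mdist x y) rho) => [xy|yx]; last first.
  (* This radius keeps [z] where the cutoff already vanishes. *)
  exists (rho / 4); first by lra.
  left => z; rewrite ballEmdist/= => yz.
  have := mdist_lipschitz x y z; rewrite ler_norml => /andP[z3 z4].
  by rewrite !split_fun_far//; lra.
have Uy : U y by case: (UWx (_ : ball x rho y)); rewrite ?ballEmdist.
have [e e0 yeU] := (openP_ball _).1 oU _ Uy.
case: (ltP (mdist x y) (rho / 2)) => [xy2|yx2].
  exists (Num.min e (rho / 2 - mdist x y)); first by rewrite lt_min e0 subr_gt0.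
  left => z yz; rewrite !split_fun_in//.
    by apply: yeU; apply: le_ball yz; rewrite ge_min lexx.
  move: yz; rewrite ballEmdist/= lt_min => /andP[_ yz].
  have := mdist_lipschitz x y z; rewrite ler_norml => /andP[z3 z4]; lra.
have Ay : annulus y by rewrite /annulus/=; apply/andP; split; lra.
have [e' e'0 yeA] := (openP_ball _).1 open_annulus _ Ay.
exists (Num.min e e'); first by rewrite lt_min e0.
right; split.
  by apply: subset_trans yeA; apply: le_ball; rewrite ge_min lexx orbT.
move=> z w yz yw.
have inU q : ball y (Num.min e e') q -> (U `&` ball x rho) q.
  move=> yq; split.
    by apply: yeU; apply: le_ball yq; rewrite ge_min lexx.
  have /yeA/andP[_] : ball y e' q by apply: le_ball yq; rewrite ge_min lexx orbT.
  by rewrite ballEmdist.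
rewrite /split_fun !indicE !mem_set ?mul1r; [|exact: inU|exact: inU].
apply: le_trans (cutoff_lipschitz _ _) _; rewrite -mulrA ler_pM2l//.
rewrite -mulrBl normrM (@gtr0_norm _ rho^-1) ?invr_gt0// mulrC.
by rewrite ler_pM2l ?invr_gt0// mdist_lipschitz.
Qed.

End Cutoff.

(** * From the Poincare inequality to unsplit balls *)

Section Poincare.
Context {R : realType} {X : pmetricType R}.
Variables (mu : {measure set (borelType X) -> \bar R}) (p : R).
Hypotheses (hball : forall (x : X) (r : R), 0 < r -> (0 < mu (ball x r) < +oo)%E)
  (p1 : 1 <= p).
Implicit Types (x y z : X) (U V W A : set X).

Lemma continuous_borel_fun (u : X -> R) : continuous u -> borel_fun (EFin \o u).
Proof.
move=> cu; apply/measurable_EFinP.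
apply: (measurability _ (RGenOpens.measurableE R)) => _ [_ [a [b ->] <-]].
rewrite setTI; apply: measurable_open.
by move/continuousP: cu; apply; exact: interval_open.
Qed.

Lemma ae_open_ex V (P : X -> Prop) : open V -> V !=set0 ->
  {ae mu, forall x : borelType X, P x} -> exists2 x, V x & P x.
Proof.
move=> oV [x Vx] [N [mN N0 PN]].
apply: contrapT => h.
have VN : V `<=` N.
  move=> y Vy; apply: PN => /= Py; by apply: h; exists y.
have [r r0 rV] := (openP_ball _).1 oV _ Vx.
have := hball x r0; rewrite ltNge => /andP[/negP + _]; apply.
rewrite -N0; apply: le_measure; rewrite ?inE//.
  by apply: measurable_open; exact: open_ball.
exact: subset_trans VN.
Qed.

(** The integrand is dominated by the [p]-th power of [M] times the indicator of [A]. *)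
Lemma integral_pow_lty (f : X -> \bar R) (M : R) A :
  measurable (A : set (borelType X)) -> (mu A < +oo)%E -> borel_fun f ->
  (forall x, `|f x| <= M%:E)%E -> (forall x, ~ A x -> f x = 0%E) ->
  (integral_pow mu p f < +oo)%E.
Proof.
move=> mA Aoo mf fM f0.
have p0 : p != 0 by rewrite gt_eqF// (lt_le_trans _ p1).
rewrite /integral_pow.
apply: (@le_lt_trans _ _ (\int[mu]_(x in [set: borelType X])
    ((M `^ p)%:E * (\1_A x)%:E))%E).
  apply: ge0_le_integral => //.
  - by move=> x _; exact: poweR_ge0.
  - apply: (measurableT_comp (measurable_poweR p)).
    exact: measurableT_comp mf.
  - apply/measurable_EFinP; apply: (@measurable_funM _ _ _ _ (cst (M `^ p))) => //.
  move=> x _; have [Ax|Ax] := pselect (A x); last first.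
    by rewrite f0// abse0 poweR0r// mule_ge0// lee_fin powR_ge0.
  rewrite indicE mem_set// mule1 -poweR_EFin.
  apply: gt0_ler_poweR => //; first by rewrite (le_trans _ p1).
  - by rewrite in_itv/= leey abse_ge0.
  - by rewrite in_itv/= leey (le_trans _ (fM x)).
have mI : measurable_fun [set: borelType X] (fun x => (\1_A x : R)%:E).
  by apply/measurable_EFinP; apply: measurable_indic.
rewrite (ge0_integralZl mu measurableT mI)//; [|by rewrite lee_fin powR_ge0].
by rewrite integral_indic// setIT lte_mul_pinfty// ?lee_fin ?powR_ge0.
Qed.

(** The exceptional family is empty, witnessed by the zero function. *)
Lemma upper_gradient_weak (u g : X -> \bar R) :
  upper_gradient u g -> weak_upper_gradient mu p u g.
Proof.
move=> [g0 gu]; split=> //; exists set0; last by move=> l gamma *; exact: gu.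
exists (cst 0%E); split=> //; first by split=> //; exact: measurable_cst.
apply: (@integral_pow_lty _ 0 set0) => //; rewrite ?measure0//.
  exact: measurable_cst.
by move=> x; rewrite abse0.
Qed.

(** The test function has zero gradient on the dilated ball, so it is almost everywhere constant on
    [ball x r]. There it is 1 on [U] and 0 on [W], so [W] cannot meet that ball. *)
Lemma poincare_unsplit_balls : poincare mu p ->
  exists theta : R, [/\ 0 < theta, theta <= 1 & unsplit_balls (X := X) theta].
Proof.
move=> [C [lam [C0 lam1 hP]]].
have lam0 : 0 < lam by exact: lt_le_trans lam1.
(* Chosen so that [lam * r] is [rho / 4], the inner radius of the annulus. *)
exists (4 * lam)^-1; split.
- by rewrite invr_gt0 mulr_gt0.
- by rewrite invf_le1 ?mulr_gt0//; lra.
move=> x rho U W rho0 oU oW UW UWx Ux.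
set r := (4 * lam)^-1 * rho.
have r0 : 0 < r by rewrite mulr_gt0// invr_gt0 mulr_gt0.
have lamr : lam * r = rho / 4 by rewrite /r; field; rewrite gt_eqF.
have rrho : r < rho / 2 by apply: (@le_lt_trans _ _ (lam * r)); [nra|lra].
pose u : X -> R := split_fun x rho U.
pose A := annulus x rho.
have oA : open A := open_annulus x rho.
have lip : locally_lipschitz_on A (4 / rho) u.
  exact: (split_fun_lipschitz rho0 oU oW UW UWx).
have rho4 : 0 <= 4 / rho by rewrite divr_ge0// ltW.
have cu : continuous u := locally_lipschitz_on_continuous rho4 lip.
pose g (y : X) := (4 / rho * \1_A y)%:E.
have ug : upper_gradient (EFin \o u) g.
  exact: locally_lipschitz_on_upper_gradient.
have bu : borel_fun (EFin \o u) := continuous_borel_fun cu.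
have mball s : measurable (ball x s : set (borelType X)).
  by apply: measurable_open; exact: open_ball.
have goo : (integral_pow mu p g < +oo)%E.
  apply: (@integral_pow_lty _ (4 / rho) (ball x rho)) => //.
  - by case/andP: (hball x rho0).
  - exact: ug.1.2.
  - move=> y; rewrite /g abse_EFin lee_fin ger0_norm; last by rewrite mulr_ge0.
    by rewrite ler_piMr// indicE lern1 leq_b1.
  - move=> y xy; rewrite /g indicE memNset ?mulr0//.
    by move=> /andP[_ ?]; apply: xy; rewrite ballEmdist.
have uN : newtonian mu p (EFin \o u).
  split=> //; apply: lte_add_pinfty; last first.
    by apply: le_lt_trans goo; apply: ereal_inf_lbound; exists g.
  apply: (@integral_pow_lty _ 1 (ball x rho)) => //.
  - by case/andP: (hball x rho0).
  - move=> y; rewrite /= lee_fin ger0_norm /u /split_fun.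
      by rewrite mulr_ile1 ?cutoff_ge0 ?cutoff_le1// indicE lern1 leq_b1.
    by rewrite mulr_ge0// cutoff_ge0.
  - move=> y xy; rewrite /= /u /split_fun indicE memNset ?mul0r//.
    by move=> [].
have [gu [[[gu0 mgu] _] _ gumin] /(_ x r r0)] := hP _ uN.
set B := ball x r; set m := average mu B (EFin \o u).
(* By minimality [gu <= g] almost everywhere, and [g] is 0 on this ball. *)
have -> : average mu (ball x (lam * r)) (fun y => gu y `^ p)%E = 0%E.
  rewrite /average -[RHS](mule0 (mu (ball x (lam * r)))^-1); congr (_ * _)%E.
  rewrite (@ge0_ae_eq_integral _ _ _ _ _ _ (cst 0%E)) ?integral0//.
  - apply: measurable_funTS.
    exact: (measurableT_comp (measurable_poweR p)).
  - by move=> y _; exact: poweR_ge0.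
  have := gumin _ (upper_gradient_weak ug) goo.
  apply: filterS => y gy xy.
  have -> : gu y = 0%E.
    apply/eqP; rewrite eq_le gu0 andbT (le_trans gy)// /g indicE memNset ?mulr0//.
    move: xy; rewrite lamr ballEmdist /A /annulus/= => xy /andP[yx _].
    by move: xy; rewrite ltNge ltW.
  by rewrite poweR0r// gt_eqF// (lt_le_trans _ p1).
rewrite poweR0r ?invr_neq0 ?gt_eqF ?(lt_le_trans _ p1)// mule0.
have /andP[B0 Boo] := hball x r0.
rewrite /average pmule_rle0; last first.
  by rewrite inve_gt0//; [rewrite gt_eqF|rewrite lt_eqF].
move=> I0.
(* The mean oscillation over [B] is 0; an infinite [m] is excluded because [u] is finite. *)
have um : {ae mu, forall y : borelType X, B y -> (u y)%:E = m}.
  have mum : measurable_fun (B : set (borelType X)) (fun y => (u y)%:E - m)%E.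
    by apply: emeasurable_funB => //; exact: measurable_funTS.
  have /(ae_eq_integral_abs mu (mball r) mum) :
      (\int[mu]_(y in (B : set (borelType X))) `|(u y)%:E - m| = 0)%E.
    by apply/eqP; rewrite eq_le I0 integral_ge0.
  apply: filterS => y h /h /= /eqP.
  by case: m {h I0 mum} => [m| |]//=; rewrite -EFinB eqe subr_eq0 => /eqP ->.
have oB : open B by exact: open_ball.
have [y [Uy By] uy] : exists2 y, (U `&` B) y & B y -> (u y)%:E = m.
  apply: ae_open_ex um; first exact: openI.
  by exists x; split=> //; exact: ballxx.
(* A point of [B] outside [U] lies in [W], and then [m] would be both 1 and 0. *)
move=> z Bz; apply: contrapT => Uz.
have [w [Ww Bw] uw] : exists2 y, (W `&` B) y & B y -> (u y)%:E = m.
  apply: ae_open_ex um; first exact: openI.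
  exists z; split=> //; case: (UWx z) => //.
  by apply: le_ball Bz; lra.
have : (u y)%:E = (u w)%:E by rewrite uy// uw.
rewrite /u split_fun_in//; last first.
  by move: By; rewrite /B ballEmdist/=; lra.
by rewrite (split_fun_notin _ _ UW)// => -[] /eqP; rewrite oner_eq0.
Qed.

End Poincare.

(** * Disjoint sets of measure bounded below *)

Section LargeDisjoint.
Context d (T : measurableType d) {R : realType}
  (mu : {measure set T -> \bar R}).

(** Any [n] members have total measure at least [n] times [m], which exceeds [mu B] for large
    [n]. *)
Lemma finite_disjoint_large (F : set (set T)) (B : set T) (m : R) :
  measurable B -> (mu B < +oo)%E -> 0 < m ->
  (forall A, F A -> [/\ measurable A, A `<=` B & (m%:E <= mu A)%E]) ->
  trivIset F id -> finite_set F.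
Proof.
move=> mB Boo m0 FA tF; apply: contrapT => infF.
have muB : mu B \is a fin_num by rewrite ge0_fin_numE.
have [n] : exists n, fine (mu B) < m *+ n.
  exists (Num.truncn (fine (mu B) / m)).+1.
  by rewrite -mulr_natl -ltr_pdivrMr// truncnS_gt.
apply/negP; rewrite -leNgt -lee_fin fineK//.
have [D DF nD] := infinite_set_fset n infF.
set S := [set` _] in DF; have finS : finite_set S by exact: finite_fset.
apply: (@le_trans _ _ (mu (\bigcup_(A in S) A))); last first.
  apply: le_measure; rewrite ?inE//.
    by apply: fin_bigcup_measurable => // A /DF /FA[].
  by apply: bigcup_sub => A /DF /FA[].
rewrite measure_fin_bigcup//=; [|exact: sub_trivIset tF|by move=> A /DF /FA[]].
apply: (@le_trans _ _ (\sum_(A \in S) m%:E)%E); last first.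
  by apply: lee_fsum => // A /DF /FA[].
rewrite fsbig_finite//= set_fsetK sumEFin lee_fin big_const_seq count_predT.
by rewrite iter_addr_0 ler_pMn2l.
Qed.

End LargeDisjoint.

(** * Components near a boundary point, Hausdorff content and John curves *)

Section Components.
Context {R : realType} {X : metricType R}.
Implicit Types (x y z : X) (A F V Omega : set X) (r s : R).

Lemma trivIset_components V : trivIset (components V) id.
Proof.
apply/trivIsetP => _ _ [x Vx <-] [y Vy <-] /eqP xy.
rewrite -subset0 => z [xz yz]; apply: xy.
by rewrite (same_connected_component xz) (same_connected_component yz).
Qed.

Lemma continuous_mdist x : continuous (mdist x : X -> R).
Proof.
move=> y; apply/cvgrPdist_lt => e e0; apply/nbhs_ballP; exists e => // z.
by rewrite ballEmdist/=; exact/le_lt_trans/mdist_lipschitz.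
Qed.

(** Otherwise the distances from [x] to the centers of a cover of [F] are midpoints of intervals of
    length [2 * r j] covering [[a, b]]; hence the factor 2. *)
Lemma connected_not_sub_content A F x (a b c : R) : connected A ->
  (exists2 y, A y & mdist x y <= a) -> (exists2 y, A y & b <= mdist x y) ->
  (hausdorff_content1 F < c%:E)%E -> 2 * c <= b - a ->
  exists2 y, A y & ~ F y /\ a <= mdist x y <= b.
Proof.
move=> cA [y Ay ya] [z Az bz] Fc cab; apply: contrapT => h.
have AF w : A w -> a <= mdist x w <= b -> F w.
  by move=> Aw ab; apply: contrapT => Fw; apply: h; exists w.
move: Fc => /ereal_inf_lt[_ [ctr [r [r0 Fr ->]]] rc].
(* By connectedness every value in [[a, b]] is the distance from [x] to some point of [A]. *)
have dA : is_interval (mdist x @` A).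
  apply/connected_intervalP/connected_continuous_connected => //.
  exact/continuous_subspaceT/continuous_mdist.
have cover : `[a, b]%classic `<=` \bigcup_j ball (mdist x (ctr j) : R) (r j).
  move=> t; rewrite /= in_itv/= => /andP[at_ tb].
  have [|||w Aw wt] := dA (mdist x y) (mdist x z) _ _ t.
  - by exists y.
  - by exists z.
  - by rewrite (le_trans ya)//= (le_trans tb).
  have /Fr[j _] : F w by apply: AF; rewrite ?wt ?at_.
  rewrite ballEmdist/= => jw; exists j => //; rewrite /ball/= -wt.
  by apply: le_lt_trans jw; exact: mdist_lipschitz.
have : ((b - a)%:E <= 2%:E * \sum_(0 <= j <oo) (r j)%:E)%E.
  apply: (@le_trans _ _ (lebesgue_measure (`[a, b]%classic : set R))).
    rewrite lebesgue_measure_itv/= lte_fin; case: ltP => // ba.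
    by rewrite lee_fin subr_le0.
  rewrite -nneseriesZl; last by move=> j _; rewrite lee_fin ltW.
  have mb j : measurable (ball (mdist x (ctr j) : R) (r j)).
    exact: measurable_ball.
  have := measure_sigma_subadditive lebesgue_measure mb (measurable_itv _) cover.
  move=> /le_trans; apply.
  rewrite le_eqVlt; apply/orP; left; apply/eqP; apply: eq_eseriesr => j _.
  by rewrite -EFinM mulr_natl; apply: lebesgue_measure_ball; exact: ltW.
apply/negP; rewrite -ltNge; apply: lt_le_trans (_ : ((2 * c)%:E <= _)%E).
  by rewrite EFinM lte_pmul2l.
by rewrite lee_fin.
Qed.

Section OpenComponents.
Hypothesis oC : forall V x, open V -> open (connected_component V x).

(** A component staying within distance [s < r] of [x] would be clopen in [Omega], hence all of
    [Omega], which contains [z]. *)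
Lemma component_reaches_sphere Omega x y z r s :
  connected Omega -> open Omega -> Omega z -> r <= mdist x z ->
  (ball x r `&` Omega) y -> s < r ->
  exists2 w, connected_component (ball x r `&` Omega) y w & s < mdist x w.
Proof.
set V := _ `&` _ => cO oO Oz rz Vy sr; apply: contrapT => h.
have hs w : connected_component V y w -> mdist x w <= s.
  by move=> Vw; rewrite leNgt; apply/negP => sw; apply: h; exists w.
have oV : open V by apply: openI => //; exact: open_ball.
have VO : connected_component V y `<=` Omega.
  by move=> w /connected_component_sub[].
have E : connected_component V y = Omega.
  apply: cO; first by exists y; exact: connected_component_refl.
    exists (connected_component V y); first exact: oC.
    by apply/esym/setIidPr.
  (* For closedness: a point of [Omega] off the component lies in another open component of [V], or
     at distance at least [r] from [x] and so at least [r - s] from the component. *)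
  exists (~` (Omega `\` connected_component V y)); last first.
    apply/seteqP; split=> [w Vw|w [Ow]].
      by split; [exact: VO|move=> []].
    by move=> /not_andP[//|/contrapT].
  apply: open_closedC; apply/openP_ball => w [Ow Vw].
  case: (ltP (mdist x w) r) => [xw|rw].
    have Vw' : V w by split=> //; rewrite ballEmdist.
    have [e e0 we] := (openP_ball _).1 (oC w oV) _ (connected_component_refl Vw').
    exists e => // q /we wq; split; first by case: (connected_component_sub wq).
    move=> yq; apply: Vw; apply: connected_component_trans yq _.
    exact: connected_component_sym.
  have [e e0 we] := (openP_ball _).1 oO _ Ow.
  exists (Num.min e (r - s)); first by rewrite lt_min e0 subr_gt0.
  move=> q wq; split.
    by apply: we; apply: le_ball wq; rewrite ge_min lexx.
  move=> /hs xq; move: wq; rewrite ballEmdist/= lt_min => /andP[_].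
  have := metric_triangle x q w; rewrite (metric_sym q w); lra.
have := Oz; rewrite -E => /hs; lra.
Qed.

(** The set [G] is [ball x s] enlarged by the components in [comps]. These are connected and remain
    whole inside [G], so each component of the new intersection contains one of them. *)
Lemma finitely_connected_at_suff Omega x : open Omega ->
  (forall r, 0 < r -> exists2 s, 0 < s <= r & finite_set
    (connected_component (ball x r `&` Omega) @` (ball x s `&` Omega))) ->
  finitely_connected_at Omega x.
Proof.
move=> oO h r r0; have [s /andP[s0 sr] fin] := h r r0.
set V := ball x r `&` Omega in fin; set comps := _ @` _ in fin.
have oV : open V by apply: openI => //; exact: open_ball.
have sV : ball x s `&` Omega `<=` V by apply: setSI; exact: le_ball.
have compsV A : comps A -> A `<=` V.
  by move=> [y _ <-]; exact: connected_component_sub.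
exists (ball x s `|` \bigcup_(A in comps) A); split.
- apply: openU; first exact: open_ball.
  by apply: bigcup_open => _ [y _ <-]; exact: oC.
- by left; exact: ballxx.
- move=> y [|[A /compsV AV /AV[]//]]; exact: le_ball.
set G := _ `&` _.
have compsG A : comps A -> A `<=` G.
  by move=> cA y Ay; split; [right; exists A|case: (compsV _ cA _ Ay)].
(* Here [xget] picks a point of [A]; its default [x] concerns only an empty [A], which does not
   occur in [comps]. *)
apply: (@sub_finite_set _ _
  ((fun A => connected_component G (xget x A)) @` comps)); last exact: finite_image.
move=> _ [y [Gy Oy] <-].
have [A cA Ay] : exists2 A, comps A & A y.
  case: Gy => [xy|[A cA Ay]]; last by exists A.
  exists (connected_component V y); first by exists y.
  by apply: connected_component_refl; exact: sV.
exists A => //; have Ag : A (xget x A) by exact: (xgetPex x (ex_intro _ y Ay)).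
apply: same_connected_component; apply: (connected_component_max Ag) Ay.
  exact: compsG.
by case: cA => [w _ <-]; exact: component_connected.
Qed.

End OpenComponents.

(* Within time s an arc-length curve stays in V, so it either ends in the
   component of its origin, or reaches a point far from the complement. *)
Lemma john_curve_component Omega V y c (C s l : R) (gamma : R -> X) :
  1 <= C -> 0 < s -> ball y (2 * s) `&` Omega `<=` V ->
  arc_length_curve l gamma -> gamma 0 = y -> gamma l = c ->
  (forall t, 0 <= t <= l -> Omega (gamma t) /\
    (t%:E <= C%:E * edist_inf (~` Omega) (gamma t))%E) ->
  connected_component V y c \/
  exists2 z, connected_component V y z & ball z (s / C) `<=` V.
Proof.
move=> C1 s0 sV cgamma g0 gl gO.
have C0 : 0 < C by exact: lt_le_trans C1.
have [l0 cg _] := cgamma.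
have lip t : 0 <= t -> t <= l -> mdist y (gamma t) <= t.
  move=> t0 tl; rewrite -g0 -[leRHS]subr0.
  exact: (arc_length_curve_lipschitz cgamma).
have comp t : 0 <= t -> t <= l -> t <= s -> connected_component V y (gamma t).
  move=> t0 tl ts.
  have gt : (gamma @` `[0, t]) (gamma t).
    by exists t => //=; rewrite in_itv/= t0 lexx.
  apply: connected_component_max gt.
  - by exists 0 => //=; rewrite in_itv/= lexx.
  - move=> _ [q /= + <-]; rewrite in_itv/= => /andP[q0 qt]; apply: sV.
    have ql : q <= l by exact: le_trans tl.
    split; last by have [] := gO q; rewrite ?q0.
    by rewrite ballEmdist/=; have := lip q q0 ql; lra.
  - apply: connected_continuous_connected; first exact: segment_connected.
    apply: continuous_subspaceW cg => q /=; rewrite !in_itv/= => /andP[-> qt].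
    exact: le_trans tl.
case: (leP l s) => ls.
  by left; rewrite -gl; exact: comp.
right; exists (gamma s); first by apply: comp => //; exact: ltW.
have [Os Cs] : Omega (gamma s) /\ (s%:E <= C%:E * edist_inf (~` Omega) (gamma s))%E.
  by apply: gO; rewrite !ltW.
move=> w sw; apply: sV; split.
  rewrite ballEmdist/=; have := lip _ (ltW s0) (ltW ls).
  have := metric_triangle y (gamma s) w.
  have : s / C <= s by rewrite ler_pdivrMr// ler_peMr// ltW.
  by move: sw; rewrite ballEmdist/=; lra.
apply: contrapT => Ow.
have dw : 0 < mdist (gamma s) w.
  by rewrite mdist_gt0; apply/eqP => E; apply: Ow; rewrite -E.
(* To apply [edist_fin] a radius strictly above the distance is needed; the midpoint is one that
   stays below [s / C]. *)
have /midf_lt[] : mdist (gamma s) w < s / C by move: sw; rewrite ballEmdist.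
set m := (_ + _) / 2 => wm ms.
have : (s%:E <= C%:E * m%:E)%E.
  apply: le_trans Cs _; rewrite lee_pmul2l//.
  apply: (@le_trans _ _ (edist (gamma s, w))).
    by apply: ereal_inf_lbound; exists w.
  by apply: edist_fin; [exact: lt_trans wm|rewrite /= ballEmdist].
by rewrite -EFinM lee_fin leNgt -ltr_pdivlMl// mulrC ms.
Qed.

End Components.

(** * Doubling and the finiteness of the set of large components *)

Section Doubling.
Context {R : realType} {X : pmetricType R}.
Variables (mu : {measure set (borelType X) -> \bar R}) (theta : R).
Hypotheses (hball : forall (x : X) (r : R), 0 < r -> (0 < mu (ball x r) < +oo)%E)
  (hdoubling : doubling mu) (theta0 : 0 < theta) (theta1 : theta <= 1)
  (unsplit : unsplit_balls (X := X) theta).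
Implicit Types (x y z : X) (A F V Omega : set X) (r s : R).

Lemma doubling_exp : exists2 C : R, 0 < C & forall x s k, 0 < s ->
  (mu (ball x (2 ^+ k * s)) <= (C ^+ k)%:E * mu (ball x s))%E.
Proof.
have [C C0 hC] := hdoubling; exists C => // x s k s0.
elim: k => [|k IH]; first by rewrite !expr0 mul1r mul1e.
rewrite !exprS -mulrA; apply: le_trans (hC _ _ _) _.
  by rewrite mulr_gt0// exprn_gt0.
by rewrite EFinM -muleA lee_pmul2l.
Qed.

(** Such a component contains [ball z (theta * rho)], and [k] doublings of this ball cover
    [ball x r], with [k] independent of the component. *)
Lemma finite_large_components V x r rho : open V -> V `<=` ball x r ->
  0 < r -> 0 < rho ->
  finite_set [set A | components V A /\ exists2 z, A z & ball z rho `<=` V].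
Proof.
move=> oV Vx r0 rho0.
have [C C0 hC] := doubling_exp.
have tr0 : 0 < theta * rho by rewrite mulr_gt0.
(* Radius [2 * r] about any point of [ball x r] suffices to cover that ball. *)
have [k hk] : exists k, 2 * r <= 2 ^+ k * (theta * rho).
  exists (Num.truncn (2 * r / (theta * rho))).+1.
  rewrite -ler_pdivrMr//; apply: (@le_trans _ _ (Num.truncn (2 * r / (theta * rho))).+1%:R).
    exact/ltW/truncnS_gt.
  by rewrite -natrX ler_nat ltnW// ltn_expl.
have mball y s : measurable (ball y s : set (borelType X)).
  by apply: measurable_open; exact: open_ball.
have /andP[mu0 muoo] := hball x r0.
have muE : (fine (mu (ball x r)))%:E = mu (ball x r).
  by rewrite fineK// ge0_fin_numE.
apply: (@finite_disjoint_large _ (borelType X) _ mu _ (ball x r)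
    (fine (mu (ball x r)) / C ^+ k)) => //.
- by rewrite divr_gt0 ?exprn_gt0// fine_gt0// mu0.
- move=> _ [[y Vy <-] [z yz zV]]; split.
  + apply: measurable_open.
    exact: (open_connected_component theta0 theta1 unsplit).
  + exact: subset_trans (@connected_component_sub _ _ _) Vx.
  + rewrite (same_connected_component yz).
    apply: (@le_trans _ _ (mu (ball z (theta * rho)))); last first.
      apply: le_measure; rewrite ?inE//.
        apply: measurable_open.
        exact: (open_connected_component theta0 theta1 unsplit).
      exact: (ball_sub_component theta0 theta1 unsplit).
    rewrite mulrC EFinM muE.
    have Vz : ball x r z by apply: Vx; exact: connected_component_sub yz.
    have xz : (mu (ball x r) <= mu (ball z (2 ^+ k * (theta * rho))))%E.
      apply: le_measure; rewrite ?inE// => w xw.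
      apply: (le_ball hk); rewrite [2 * r]mulr_natl mulr2n.
      by apply: ball_triangle xw; exact: ball_sym.
    have := le_trans xz (hC z (theta * rho) k tr0).
    move: (mu _) (mu _) => a b ab.
    by rewrite muleC lee_pdivrMr ?exprn_gt0// muleC.
- apply: sub_trivIset (@trivIset_components _ _ V).
  by move=> A [].
Qed.

(** Content below [r / 8] cannot block an annulus of width [r / 2], and a walk of length [r / 8]
    starting within [3 / 4 * r] of [x] stays in [ball x r]. The John constant may depend on [r],
    which is fixed here. *)
Lemma almost_john_finite_components Omega x r : 0 < r -> domain Omega ->
  almost_john_domain Omega ->
  finite_set (connected_component (ball x r `&` Omega) @`
    (ball x (r / 4) `&` Omega)).
Proof.
move=> r0 [_ cO oO] [_ /(_ (r / 8))[]]; first by rewrite divr_gt0.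
move=> F [cF _ Fr [_ [C [c [C1 Oc john]]]]].
set V := ball x r `&` Omega.
have oV : open V by apply: openI => //; exact: open_ball.
have [sO|/existsNP[z /not_implyP[Oz xz]]] := pselect (Omega `<=` ball x r).
  apply: (@sub_finite_set _ _ [set Omega]); last exact: finite_set1.
  move=> _ [y [_ Oy] <-] /=; rewrite /V (setIidr sO).
  exact: connected_component_id.
have rz : r <= mdist x z by rewrite leNgt; apply/negP; move: xz; rewrite ballEmdist.
pose s := r / 8; have s0 : 0 < s by rewrite divr_gt0.
(* If the John center [c] is not in [V], the first set is merely an extra empty member. *)
apply: (@sub_finite_set _ _ (connected_component V c |` [set A | components V A /\
    exists2 z, A z & ball z (s / C) `<=` V])); last first.
  rewrite finite_setU; split; first exact: finite_set1.
  apply: (@finite_large_components _ x r) => //.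
    by move=> w [].
  by rewrite divr_gt0// (lt_le_trans _ C1).
move=> _ [y [xy Oy] <-].
have Vy : V y.
  by split=> //; apply: le_ball xy; lra.
have [w yw hw] : exists2 w, connected_component V y w & 3 / 4 * r < mdist x w.
  apply: (component_reaches_sphere _ cO oO Oz rz Vy); last by lra.
  by move=> U u oU; exact: (open_connected_component theta0 theta1 unsplit).
have [q yq [Fq /andP[rq qr]]] : exists2 q, connected_component V y q &
    ~ F q /\ r / 4 <= mdist x q <= 3 / 4 * r.
  apply: (connected_not_sub_content _ _ _ Fr); last by lra.
  - exact: component_connected.
  - exists y; first exact: connected_component_refl.
    by move: xy; rewrite ballEmdist => /ltW.
  - by exists w => //; exact: ltW.
have Oq : (Omega `\` F) q by split=> //; case: (connected_component_sub yq).
have [l [gamma [cgamma g0 gl gO]]] := john q Oq.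
(* The curve lemma is applied to [Omega] without [F], whereas the components are those of [V], from
   which [F] is not removed. *)
have sV : ball q (2 * s) `&` (Omega `\` F) `<=` V.
  move=> u [qu [Ou _]]; split=> //; move: qu; rewrite !ballEmdist/= /s.
  have := metric_triangle x q u; lra.
rewrite (same_connected_component yq).
have [qc|[u qu uV]] := john_curve_component C1 s0 sV cgamma g0 gl gO.
  by left; exact: same_connected_component.
right; split; last by exists u.
by exists q => //; exact: connected_component_sub yq.
Qed.

End Doubling.

Theorem theorem11p5 (R : realType) (X : completeMetricType R)
    (mu : {measure set (borelType X) -> \bar R}) (p : R) (Omega : set X)
    (hX : exists x y : X, x <> y)
    (hball : forall (x : X) (r : R), 0 < r -> (0 < mu (ball x r) < +oo)%E)
    (hp : 1 <= p)
    (hdoubling : doubling mu)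
    (hpoincare : poincare mu p)
    (hdomain : domain Omega)
    (hbounded : bounded_subset Omega)
    (hproper : Omega <> [set: X]) :
  almost_john_domain Omega -> finitely_connected_at_boundary Omega.
Proof.
move=> john x _.
have [theta [theta0 theta1 unsplit]] := poincare_unsplit_balls hball hp hpoincare.
have [_ _ oO] := hdomain.
apply: finitely_connected_at_suff => // [V y|r r0].
  exact: (open_connected_component theta0 theta1 unsplit).
exists (r / 4); first by apply/andP; split; lra.
exact: (almost_john_finite_components hball hdoubling theta0 theta1 unsplit).
Qed.
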